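(* Let $1\to H\xrightarrow{f}G\xrightarrow{g}G/H\to1$ be a short exact sequence of groups, where $H$ and $G$ are equipped with conjugation invariant norms $\|\cdot\|_H$, $\|\cdot\|_G$ such that $\|\cdot\|_G$ is the word norm generated by a set $S\subset G$ and $f$ is a quasi-isometric embedding. Moreover, assume that the norm $\|\cdot\|_{G/H}$ on $G/H$ is the word norm generated by $g(S)$. Let $\omega$ be a non-principal ultrafilter on $\mathbb{N}$. Then the short exact sequence gives rise to a short exact sequence of asymptotic cones $$1\to \mathrm{Cone}_\omega(H,\|\cdot\|_H)\xrightarrow{\widehat f}\mathrm{Cone}_\omega(G,\|\cdot\|_G)\xrightarrow{\widehat g}\mathrm{Cone}_\omega(G/H,\|\cdot\|_{G/H})\to1,$$ where $\widehat f([x_n])=[f(x_n)]$ and $\widehat g([x_n])=[g(x_n)]$.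
   Context: A norm on a group $G$ is $\nu:G\to[0,\infty)$ with $\nu(g)=0$ iff $g=1$, $\nu(gh)\le\nu(g)+\nu(h)$ and $\nu(g^{-1})=\nu(g)$; it is conjugation invariant if $\nu(hgh^{-1})=\nu(g)$. It induces the metric $d(g,h)=\nu(gh^{-1})$. The conjugation invariant word norm generated by $S\subset G$ is the minimal number of factors needed to write an element as a product of conjugates of elements of $S\cup S^{-1}$ (these conjugates being assumed to generate $G$). A map $f:(X,d)\to(X',d')$ is a quasi-isometric embedding if there are $A\ge1$, $B\ge0$ with $\frac1Ad(x,y)-B\le d'(f(x),f(y))\le Ad(x,y)+B$ for all $x,y$. Asymptotic cone (scaling sequence $s_n=n$): a sequence $(x_n)_{n\ge1}$ in $G$ is admissible if $\|x_n\|/n$ is bounded; $\mathrm{Cone}_\omega(G,\|\cdot\|)$ is the set of admissible sequences modulo $(x_n)\sim(y_n)$ iff $\lim_\omega d(x_n,y_n)/n=0$, with metric $\lim_\omega d(x_n,y_n)/n$. For a conjugation invariant norm it is a (topological) group under termwise multiplication. *)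

(* Defs.v *)
From HB Require Import structures.
From mathcomp Require Import all_boot all_order all_algebra generic_quotient.
From mathcomp Require Import all_classical all_reals all_analysis.
From mathcomp Require Import lra.

Set Implicit Arguments.
Unset Strict Implicit.
Unset Printing Implicit Defensive.

Import Order.TTheory GRing.Theory Num.Theory.
Import numFieldNormedType.Exports.

Local Open Scope classical_set_scope.
Local Open Scope ring_scope.
Local Open Scope quotient_scope.

(** * Conjugation invariant norms on (arbitrary) groups *)

Record cinorm (R : realType) (G : groupType) := CINorm {
  cinorm_fun :> G -> R;
  cinorm_ge0 : forall g, 0 <= cinorm_fun g;
  cinorm_eq0 : forall g, cinorm_fun g = 0 <-> g = 1%g;
  cinormM : forall g h, cinorm_fun (g * h)%g <= cinorm_fun g + cinorm_fun h;
  cinormV : forall g, cinorm_fun g^-1%g = cinorm_fun g;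
  cinormJ : forall g h, cinorm_fun (h * g * h^-1)%g = cinorm_fun g
}.

Definition norm_dist (R : realType) (G : groupType) (nu : G -> R) (g h : G) : R :=
  nu (g * h^-1)%g.

Definition conjugates (G : groupType) (S : set G) : set G :=
  [set (h * s * h^-1)%g | s in S `|` [set s^-1%g | s in S] & h in setT].

Definition conj_word (G : groupType) (S : set G) (n : nat) (g : G) : Prop :=
  exists w : 'I_n -> G,
    (forall i, conjugates S (w i)) /\ g = (\prod_(i < n) w i)%g.

(** The existence of [n] for every [g] includes the assumption that the
    conjugates of [S] and of its inverses generate [G]. *)
Definition is_conj_word_norm (R : realType) (G : groupType) (S : set G)
    (nu : G -> R) : Prop :=
  forall g, exists n : nat,
    [/\ conj_word S n g,
        forall m, conj_word S m g -> (n <= m)%N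
      & nu g = n%:R].

Definition quasi_isometric_embedding (R : realType) (X Y : Type)
    (dX : X -> X -> R) (dY : Y -> Y -> R) (f : X -> Y) : Prop :=
  exists A B : R, [/\ 1 <= A, 0 <= B &
    forall x y, A^-1 * dX x y - B <= dY (f x) (f y) <= A * dX x y + B].

Definition short_exact (A B C : groupType) (f : {multiplicative A -> B})
    (g : {multiplicative B -> C}) : Prop :=
  [/\ injective f, range f = [set b | g b = 1%g] & range g = setT].

(** * Asymptotic cones

    The sequences of the cone are indexed by the positive integers: the term
    of index [n : nat] stands for the (n+1)-st one, hence the factor [n.+1]. *)

Definition admissible (R : realType) (G : groupType) (nu : cinorm R G)
    (x : nat -> G) : Prop :=
  exists C : R, forall n, nu (x n) / n.+1%:R <= C.

Record admissible_seq (R : realType) (G : groupType) (nu : cinorm R G) :=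
  AdmissibleSeq { seq_fun :> nat -> G; seq_funP : admissible nu seq_fun }.

HB.instance Definition _ (R : realType) (G : groupType) (nu : cinorm R G) :=
  gen_eqMixin (admissible_seq nu).
HB.instance Definition _ (R : realType) (G : groupType) (nu : cinorm R G) :=
  gen_choiceMixin (admissible_seq nu).

Section Norm.
Context (R : realType) (G : groupType) (nu : cinorm R G).
Implicit Types (g h k : G) (x y z : admissible_seq nu).

Lemma cinorm1 : nu 1%g = 0. Proof. exact/cinorm_eq0. Qed.

Lemma norm_distxx g : norm_dist nu g g = 0.
Proof. by rewrite /norm_dist mulgV cinorm1. Qed.

Lemma norm_dist_sym g h : norm_dist nu g h = norm_dist nu h g.
Proof. by rewrite /norm_dist -cinormV invgM invgK. Qed.

Lemma norm_dist_triangle h g k :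
  norm_dist nu g k <= norm_dist nu g h + norm_dist nu h k.
Proof.
by apply: le_trans (cinormM nu _ _); rewrite mulgA mulgVK.
Qed.

Lemma norm_distM g g' h h' :
  norm_dist nu (g * h)%g (g' * h')%g <= norm_dist nu g g' + norm_dist nu h h'.
Proof.
rewrite /norm_dist -(cinormJ nu (h * h'^-1)%g g') addrC.
have -> : (g * h * (g' * h')^-1 = g * g'^-1 * (g' * (h * h'^-1) * g'^-1))%g.
  by rewrite invgM !mulgA mulgVK.
by rewrite addrC cinormM.
Qed.

Lemma norm_distV g h : norm_dist nu g^-1%g h^-1%g = norm_dist nu g h.
Proof.
rewrite /norm_dist -[in RHS]cinormV -(cinormJ nu (g^-1 * _)%g g).
by rewrite invgM !invgK mulgA mulgV mul1g.
Qed.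

Definition scaled_dist (x y : nat -> G) (n : nat) : R :=
  norm_dist nu (x n) (y n) / n.+1%:R.

Lemma scaled_dist_ge0 (x y : nat -> G) n : 0 <= scaled_dist x y n.
Proof. by rewrite divr_ge0// cinorm_ge0. Qed.

Lemma scaled_dist_triangle (y x z : nat -> G) n :
  scaled_dist x z n <= scaled_dist x y n + scaled_dist y z n.
Proof. by rewrite -mulrDl ler_pM2r ?invr_gt0// norm_dist_triangle. Qed.

Lemma scaled_dist_sym (x y : nat -> G) n : scaled_dist x y n = scaled_dist y x n.
Proof. by rewrite /scaled_dist norm_dist_sym. Qed.

Lemma admissible1 : admissible nu (fun=> 1%g).
Proof. by exists 0 => n; rewrite cinorm1 mul0r. Qed.

Lemma admissibleM x y : admissible nu (fun n => (x n * y n)%g).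
Proof.
have [[C xC] [D yD]] := (seq_funP x, seq_funP y).
exists (C + D) => n; apply: le_trans (lerD (xC n) (yD n)).
by rewrite -mulrDl ler_pM2r ?invr_gt0// cinormM.
Qed.

Lemma admissibleV x : admissible nu (fun n => (x n)^-1%g).
Proof. by have [C xC] := seq_funP x; exists C => n; rewrite cinormV. Qed.

Definition aseq1 := AdmissibleSeq admissible1.
Definition aseqM x y := AdmissibleSeq (admissibleM x y).
Definition aseqV x := AdmissibleSeq (admissibleV x).

Lemma scaled_dist_bounded x y : exists C, forall n, scaled_dist x y n <= C.
Proof. exact: admissibleM x (aseqV y). Qed.

End Norm.

Section Cone.
Context (R : realType) (G : groupType) (w : set_system nat) {wU : UltraFilter w}
  (nu : cinorm R G).
Implicit Types (x y z : admissible_seq nu).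

Definition cone_rel x y : bool :=
  `[< scaled_dist nu x y n @[n --> w] --> (0 : R) >].

Lemma squeeze0 (u v : nat -> R) : (forall n, 0 <= u n <= v n) ->
  v n @[n --> w] --> (0 : R) -> u n @[n --> w] --> (0 : R).
Proof.
by move=> uv; apply: squeeze_cvgr (cvg_cst _); apply: nearW.
Qed.

Lemma cone_rel_refl : reflexive cone_rel.
Proof.
move=> x; apply/asboolP; rewrite (_ : scaled_dist nu x x = cst 0).
  exact: cvg_cst.
by apply/funext => n; rewrite /scaled_dist norm_distxx mul0r.
Qed.

Lemma cone_rel_sym : symmetric cone_rel.
Proof.
move=> x y; rewrite /cone_rel.
by rewrite (_ : scaled_dist nu x y = scaled_dist nu y x)//;
  apply/funext => n; rewrite scaled_dist_sym.
Qed.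

Lemma cone_rel_trans : transitive cone_rel.
Proof.
move=> y x z /asboolP xy /asboolP yz; apply/asboolP.
apply: (@squeeze0 _ (fun n => scaled_dist nu x y n + scaled_dist nu y z n)).
  by move=> n; rewrite scaled_dist_ge0 scaled_dist_triangle.
by rewrite -[X in _ --> X]addr0; apply: cvgD.
Qed.

Canonical cone_equiv := EquivRel cone_rel cone_rel_refl cone_rel_sym cone_rel_trans.

Definition cone : Type := {eq_quot cone_rel}.

HB.instance Definition _ := Choice.on cone.
HB.instance Definition _ := EqQuotient.on cone.

Definition cone_class (x : nat -> G) (hx : admissible nu x) : cone :=
  \pi_cone (AdmissibleSeq hx).

Lemma cone_eqP x y :
  \pi_cone x = \pi_cone y <-> scaled_dist nu x y n @[n --> w] --> (0 : R).
Proof.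
split; first by move/eqquotP => /asboolP.
by move=> xy; apply/eqquotP/asboolP.
Qed.

(** Group structure: termwise multiplication. *)

Definition cone1 : cone := \pi_cone (aseq1 nu).
Definition coneM (a b : cone) : cone := \pi_cone (aseqM (repr a) (repr b)).
Definition coneV (a : cone) : cone := \pi_cone (aseqV (repr a)).

Lemma repr_rel x : scaled_dist nu (repr (\pi_cone x)) x n @[n --> w] --> (0 : R).
Proof. by apply/cone_eqP; rewrite reprK. Qed.

Lemma coneME x y : coneM (\pi_cone x) (\pi_cone y) = \pi_cone (aseqM x y).
Proof.
apply/cone_eqP.
apply: (@squeeze0 _ (fun n => scaled_dist nu (repr (\pi_cone x)) x n +
                              scaled_dist nu (repr (\pi_cone y)) y n)).
  move=> n; rewrite scaled_dist_ge0/= -mulrDl ler_pM2r ?invr_gt0//.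
  exact: norm_distM.
by rewrite -[X in _ --> X]addr0; apply: cvgD; exact: repr_rel.
Qed.

Lemma coneVE x : coneV (\pi_cone x) = \pi_cone (aseqV x).
Proof.
apply/cone_eqP; have := @repr_rel x.
rewrite (_ : scaled_dist nu (aseqV (repr (\pi_cone x))) (aseqV x) =
             scaled_dist nu (repr (\pi_cone x)) x)//.
by apply/funext => n; rewrite /scaled_dist norm_distV.
Qed.

Lemma eq_cone_pi x y : (forall n, x n = y n) -> \pi_cone x = \pi_cone y.
Proof.
move=> xy; congr (\pi_cone _); case: x y xy => [x hx] [y hy] /= /funext xy.
by subst y; congr AdmissibleSeq; exact: Prop_irrelevance.
Qed.

Lemma coneMA : associative coneM.
Proof.
elim/quotW=> x; elim/quotW=> y; elim/quotW=> z; rewrite (coneME y z) (coneME x y) !coneME.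
by apply: eq_cone_pi => n /=; rewrite mulgA.
Qed.

Lemma cone1M : left_id cone1 coneM.
Proof.
elim/quotW=> x; rewrite coneME.
by apply: eq_cone_pi => n /=; rewrite mul1g.
Qed.

Lemma coneM1 : right_id cone1 coneM.
Proof.
elim/quotW=> x; rewrite coneME.
by apply: eq_cone_pi => n /=; rewrite mulg1.
Qed.

Lemma coneVM : left_inverse cone1 coneV coneM.
Proof.
elim/quotW=> x; rewrite coneVE coneME.
by apply: eq_cone_pi => n /=; rewrite mulVg.
Qed.

Lemma coneMV : right_inverse cone1 coneV coneM.
Proof.
elim/quotW=> x; rewrite coneVE coneME.
by apply: eq_cone_pi => n /=; rewrite mulgV.
Qed.

HB.instance Definition _ :=
  isGroup.Build cone coneMA cone1M coneM1 coneVM coneMV.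

(** Metric structure: the limit of the rescaled distances along [w]. *)

Definition cone_dist (a b : cone) : R :=
  lim (scaled_dist nu (repr a) (repr b) n @[n --> w]).

Lemma scaled_dist_cvg x y :
  exists l : R, scaled_dist nu x y n @[n --> w] --> l.
Proof.
have [C xyC] := scaled_dist_bounded x y.
have wP : ProperFilter (scaled_dist nu x y n @[n --> w]) by exact: fmap_proper_filter.
have := @segment_compact R 0 C; move=> /(_ _ wP)[].
  by apply: nearW => n /=; rewrite in_itv/= scaled_dist_ge0 xyC.
move=> l [_ clul]; exists l => A lA.
have [//|wNA] := in_ultra_setVsetC (scaled_dist nu x y @^-1` A) wU.
by have [z [/= NAz Az]] := clul (~` A) A wNA lA.
Qed.

Lemma cone_distE x y (l : R) : scaled_dist nu x y n @[n --> w] --> l ->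
  cone_dist (\pi_cone x) (\pi_cone y) = l.
Proof.
move=> xyl; apply: cvg_lim => //.
pose e n := scaled_dist nu (repr (\pi_cone x)) x n +
            scaled_dist nu (repr (\pi_cone y)) y n.
have e0 : e n @[n --> w] --> (0 : R).
  by rewrite -[X in _ --> X]addr0; apply: cvgD; exact: repr_rel.
apply: (@squeeze_cvgr _ _ _ _ (fun n => scaled_dist nu x y n - e n)
  (fun n => scaled_dist nu x y n + e n)).
- apply: nearW => n; rewrite /e.
  set a := repr _; set b := repr _.
  have := scaled_dist_triangle nu x a b n.
  have := scaled_dist_triangle nu y x b n.
  have := scaled_dist_triangle nu a x y n.
  have := scaled_dist_triangle nu b a y n.
  rewrite (scaled_dist_sym nu x a) (scaled_dist_sym nu y b).
  by move=> *; apply/andP; split; lra.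
- by rewrite -[l]subr0; apply: cvgB.
- by rewrite -[l]addr0; apply: cvgD.
Qed.

Lemma cone_distxx a : cone_dist a a = 0.
Proof. by elim/quotW: a => x; apply: (@cone_distE x x 0); exact/cone_eqP. Qed.

Lemma cone_dist_eq0 a b : cone_dist a b = 0 -> a = b.
Proof.
elim/quotW: a => x; elim/quotW: b => y; have [l abl] := scaled_dist_cvg x y.
by rewrite (cone_distE abl) => l0; apply/cone_eqP; rewrite -l0.
Qed.

Lemma cone_dist_sym a b : cone_dist a b = cone_dist b a.
Proof.
rewrite /cone_dist (_ : scaled_dist nu (repr a) _ =
                          scaled_dist nu (repr b) (repr a))//.
by apply/funext => n; rewrite scaled_dist_sym.
Qed.

Lemma cone_dist_triangle b a c : cone_dist a c <= cone_dist a b + cone_dist b c.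
Proof.
elim/quotW: a => x; elim/quotW: b => y; elim/quotW: c => z.
have [k abk] := scaled_dist_cvg x y.
have [l bcl] := scaled_dist_cvg y z.
have [m acm] := scaled_dist_cvg x z.
rewrite (cone_distE abk) (cone_distE bcl) (cone_distE acm).
apply: (ler_cvg_to acm (cvgD abk bcl)).
by apply: nearW => n; exact: scaled_dist_triangle.
Qed.

HB.instance Definition _ := isMetric.Build R cone
  cone_distxx cone_dist_eq0 cone_dist_sym cone_dist_triangle.

End Cone.

Arguments cone {R G} w {wU} nu.
Arguments cone_class {R G} w {wU nu x} hx.

(* Main.v *)
(** Everything rests on two observations.  A homomorphism [phi] with
    [nu' (phi x) <= A * nu x + B] acts termwise on the asymptotic cones, since
    the additive constant [B] is divided by [n], which tends to infinity along
    a non-principal ultrafilter; the induced map is [A]-Lipschitz.  And every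
    [q : Q] lifts along [g] to an element of norm at most [nuQ q], by lifting
    the conjugates of generators of a minimal word one by one.  Lifting term by
    term gives the surjectivity of [ghat].  If [ghat [x_n] = 1], lift [g (x_n)]
    to [y_n] of norm [o(n)]; then [x_n y_n^-1 = f (h_n)], the sequence [h_n] is
    admissible because [f] is a quasi-isometric embedding, and
    [fhat [h_n] = [x_n]]. *)

Require Import Defs.
From HB Require Import structures.
From mathcomp Require Import all_boot all_order all_algebra.
From mathcomp Require Import all_classical all_reals all_analysis.

Set Implicit Arguments.
Unset Strict Implicit.
Unset Printing Implicit Defensive.

Import Order.TTheory GRing.Theory Num.Theory.
Import numFieldNormedType.Exports.

Local Open Scope classical_set_scope.
Local Open Scope ring_scope.
Local Open Scope quotient_scope.

(** * Homomorphisms and words in conjugates of generators *)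

Section GroupHom.
Context (G Q : groupType) (g : {multiplicative G -> Q}).

(* [{multiplicative G -> Q}] is only a magma morphism, so [gmulf1] and [gmulfV]
   do not apply to it. *)
Lemma ghom1 : g 1%g = 1%g.
Proof. by apply: (mulgI (g 1%g)); rewrite -gmulfM !mulg1. Qed.

Lemma ghomV x : g x^-1%g = (g x)^-1%g.
Proof. by apply: (mulgI (g x)); rewrite -gmulfM !mulgV ghom1. Qed.

Lemma ghom_prod n (w : 'I_n -> G) :
  g (\prod_(i < n) w i)%g = (\prod_(i < n) g (w i))%g.
Proof. exact: (big_morph g gmulfM ghom1). Qed.

Context (S : set G).

Lemma conjugates_image x : conjugates S x -> conjugates (g @` S) (g x).
Proof.
case=> s Ss [h _ <-].
exists (g s); last by exists (g h) => //; rewrite !gmulfM ghomV.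
case: Ss => [Ss|[t St <-]]; first by left; exists s.
by right; exists (g t); [exists t|rewrite ghomV].
Qed.

Lemma conj_word_image n x : conj_word S n x -> conj_word (g @` S) n (g x).
Proof.
move=> [w [wS ->]]; exists (g \o w); split; last exact: ghom_prod.
by move=> i; apply: conjugates_image.
Qed.

Hypothesis g_surj : range g = setT.

Lemma conjugates_lift q :
  conjugates (g @` S) q -> exists x, conjugates S x /\ g x = q.
Proof.
case=> s Ss [k _ <-].
have [h _ <-] : range g k by rewrite g_surj.
have [t tS <-] : exists2 t, (S `|` [set s^-1%g | s in S]) t & g t = s.
  case: Ss => [[t St <-]|[_ [t St <-] <-]]; first by exists t => //; left.
  by exists t^-1%g; [right; exists t|rewrite ghomV].
exists (h * t * h^-1)%g; split; last by rewrite !gmulfM ghomV.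
by exists t => //; exists h.
Qed.

Lemma conj_word_lift n q :
  conj_word (g @` S) n q -> exists2 x, conj_word S n x & g x = q.
Proof.
move=> [w [wS ->]].
have [v vP] := choice (fun i => conjugates_lift (wS i)).
exists (\prod_(i < n) v i)%g; first by exists v; split=> // i; have [] := vP i.
by rewrite ghom_prod; apply: eq_bigr => i _; have [] := vP i.
Qed.

End GroupHom.

Section WordNorm.
Context (R : realType) (G Q : groupType) (g : {multiplicative G -> Q}).
Context (S : set G) (nuG : cinorm R G) (nuQ : cinorm R Q).
Hypothesis nuGS : is_conj_word_norm S nuG.
Hypothesis nuQS : is_conj_word_norm (g @` S) nuQ.

(** A minimal word for [x] maps to a word of the same length for [g x]. *)
Lemma word_norm_image_le x : nuQ (g x) <= nuG x.
Proof.
have [n [xn _ ->]] := nuGS x; have [m [_ m_min ->]] := nuQS (g x).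
by rewrite ler_nat; apply/m_min/conj_word_image.
Qed.

Lemma word_norm_lift q : range g = setT -> exists x, g x = q /\ nuG x <= nuQ q.
Proof.
move=> g_surj; have [m [qm _ ->]] := nuQS q.
have [x xm gxq] := conj_word_lift g_surj qm.
have [n [_ n_min nuGx]] := nuGS x.
by exists x; split=> //; rewrite nuGx ler_nat n_min.
Qed.

End WordNorm.

(** The complement of every singleton belongs to [w]; intersecting finitely many of them gives every
    tail. *)
Lemma nonprincipal_ultra_cvg (w : set_system nat) : UltraFilter w ->
  (forall n, w <> principal_filter n) -> w --> \oo.
Proof.
move=> wU w_np A [N _ NA].
have wne n : w (~` [set n]).
  have [wn|//] := in_ultra_setVsetC [set n] wU; case: (w_np n).
  (* If [w] contained the singleton of [n], it would contain the principal ultrafilter at [n], hence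
     equal it by maximality. *)
  apply: (@max_filter _ _ (principal_filter_ultra n) w _).
  move=> B /principal_filterP Bn.
  by apply: filterS wn => _ ->.
suff : w [set n | (N <= n)%N] by apply: filterS.
elim: N {NA} => [|N IHN]; first exact: filterS filterT.
apply: filterS (filterI IHN (wne N)) => n [/= Nn nN].
by rewrite ltn_neqAle Nn andbT; apply/eqP => Nn'; exact: nN.
Qed.

(** * Functoriality of the cone for homomorphisms with an affine norm bound *)

Section ConeMap.
Context (R : realType) (w : set_system nat) {wU : UltraFilter w}.
Hypothesis w_np : forall n, w <> principal_filter n.

Lemma ultra_cvg_inv_index (B : R) : B / n.+1%:R @[n --> w] --> (0 : R).
Proof.
rewrite -[X in _ --> X](mulr0 B); apply: cvgM; first exact: cvg_cst.
apply: cvg_trans (@cvg_harmonic R); apply: cvg_app.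
exact: nonprincipal_ultra_cvg.
Qed.

Lemma cvg0_affine_le (A B : R) (u v : nat -> R) :
  (forall n, 0 <= u n <= A * v n + B / n.+1%:R) ->
  v n @[n --> w] --> (0 : R) -> u n @[n --> w] --> (0 : R).
Proof.
move=> uv v0; apply: squeeze0 uv _.
rewrite -[X in _ --> X](addr0 (0 : R)).
apply: cvgD; last exact: ultra_cvg_inv_index.
by rewrite -[X in _ --> X](mulr0 A); apply: cvgM => //; exact: cvg_cst.
Qed.

Context (G G' : groupType) (nu : cinorm R G) (nu' : cinorm R G').
Context (phi : {multiplicative G -> G'}) (A B : R).
Hypotheses (A0 : 0 < A) (B0 : 0 <= B).
Hypothesis phi_le : forall x, nu' (phi x) <= A * nu x + B.

Lemma scaled_norm_le x n :
  nu' (phi x) / n.+1%:R <= A * (nu x / n.+1%:R) + B / n.+1%:R.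
Proof. by rewrite mulrA -mulrDl ler_pM2r ?invr_gt0. Qed.

Lemma admissible_image x : admissible nu x -> admissible nu' (phi \o x).
Proof.
move=> [C xC]; exists (A * C + B) => n; apply: le_trans (scaled_norm_le _ _) _.
apply: lerD; first by rewrite ler_pM2l.
by rewrite ler_pdivrMr// ler_peMr// ler1n.
Qed.

Definition aseq_image (x : admissible_seq nu) :=
  AdmissibleSeq (admissible_image (seq_funP x)).

Lemma scaled_dist_image_le (x y : nat -> G) n :
  scaled_dist nu' (phi \o x) (phi \o y) n <=
  A * scaled_dist nu x y n + B / n.+1%:R.
Proof.
by rewrite /scaled_dist /norm_dist /= -ghomV -gmulfM scaled_norm_le.
Qed.

Definition cone_map (a : cone w nu) : cone w nu' :=
  \pi_(cone w nu') (aseq_image (repr a)).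

Lemma cone_map_pi (x : admissible_seq nu) :
  cone_map (\pi_(cone w nu) x) = \pi_(cone w nu') (aseq_image x).
Proof.
apply/cone_eqP; apply: cvg0_affine_le (repr_rel x) => n.
by rewrite scaled_dist_ge0; exact: scaled_dist_image_le.
Qed.

Lemma cone_mapM : {morph cone_map : a b / (a * b)%g}.
Proof.
elim/quotW=> x; elim/quotW=> y.
(* The product here is that of the group structure on the cone, which matches [coneM] only up to
   conversion. *)
rewrite /= [LHS](congr1 cone_map (coneME _ _)) !cone_map_pi.
rewrite [RHS]coneME.
by apply: eq_cone_pi => n /=; rewrite gmulfM.
Qed.

HB.instance Definition _ := isMultiplicative.Build _ _ cone_map cone_mapM.

Lemma cone_map_lipschitz a b :
  cone_dist (cone_map a) (cone_map b) <= A * cone_dist a b.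
Proof.
elim/quotW: a => x; elim/quotW: b => y; rewrite !cone_map_pi.
have [k xyk] := scaled_dist_cvg (wU := wU) x y.
have [l fxyl] := scaled_dist_cvg (wU := wU) (aseq_image x) (aseq_image y).
rewrite (cone_distE xyk) (cone_distE fxyl) -[leRHS]addr0.
apply: (ler_cvg_to fxyl).
  by apply: cvgD (ultra_cvg_inv_index B); apply: cvgM xyk; exact: cvg_cst.
by apply: nearW => n; exact: scaled_dist_image_le.
Qed.

Lemma cone_map_continuous : continuous cone_map.
Proof.
move=> a; apply/(@metricType_numDomainType.cvgrPdist_lt _ _ _ (nbhs a)) => e e0.
apply/metricType_numDomainType.nbhs_mdistP.
exists (e / A); first exact: divr_gt0.
move=> b /= ab; apply: le_lt_trans (cone_map_lipschitz a b) _.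
by rewrite mulrC -ltr_pdivlMr.
Qed.

Lemma cone_map_exists :
  exists phat : {multiplicative cone w nu -> cone w nu'},
    (forall (x : nat -> G) (hx : admissible nu x),
       exists hfx : admissible nu' (phi \o x),
         phat (cone_class w hx) = cone_class w hfx) /\ continuous phat.
Proof.
exists cone_map; split; last exact: cone_map_continuous.
by move=> x hx; exists (admissible_image hx); exact: cone_map_pi.
Qed.

End ConeMap.

(** * Exactness of the sequence of cones *)

Lemma norm_dist1 (R : realType) (G : groupType) (nu : cinorm R G) x :
  norm_dist nu x 1%g = nu x.
Proof. by rewrite /norm_dist invg1 mulg1. Qed.

(** Exposes a sequence with its admissibility proof, the form in which [fhat] and [ghat] are
    specified. *)
Lemma cone_class_ind (R : realType) (G : groupType) (nu : cinorm R G)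
    (w : set_system nat) (wU : UltraFilter w) (P : cone w nu -> Prop) :
  (forall x (hx : admissible nu x), P (cone_class w hx)) -> forall a, P a.
Proof. by move=> PP; elim/quotW=> -[x hx]; exact: PP. Qed.

Lemma cone_classP (R : realType) (G : groupType) (nu : cinorm R G)
    (w : set_system nat) (wU : UltraFilter w) (x y : nat -> G)
    (hx : admissible nu x) (hy : admissible nu y) :
  cone_class w hx = cone_class w hy <->
  scaled_dist nu x y n @[n --> w] --> (0 : R).
Proof. exact: cone_eqP. Qed.

Lemma cone_class_eq1 (R : realType) (G : groupType) (nu : cinorm R G)
    (w : set_system nat) (wU : UltraFilter w) (x : nat -> G)
    (hx : admissible nu x) :
  cone_class w hx = 1%g <-> nu (x n) / n.+1%:R @[n --> w] --> (0 : R).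
Proof.
rewrite (_ : (fun n => _) = scaled_dist nu x (fun=> 1%g)).
  exact: (cone_classP _ hx (admissible1 nu)).
by apply/funext => n; rewrite /scaled_dist norm_dist1.
Qed.

Theorem lemma3p2 (R : realType) (H G Q : groupType)
    (f : {multiplicative H -> G}) (g : {multiplicative G -> Q})
    (nuH : cinorm R H) (nuG : cinorm R G) (nuQ : cinorm R Q) (S : set G)
    (w : set_system nat) (wU : UltraFilter w) :
  short_exact f g ->
  is_conj_word_norm S nuG ->
  quasi_isometric_embedding (norm_dist nuH) (norm_dist nuG) f ->
  is_conj_word_norm (g @` S) nuQ ->
  (forall n : nat, w <> principal_filter n) ->
  exists (fhat : {multiplicative cone w nuH -> cone w nuG})
         (ghat : {multiplicative cone w nuG -> cone w nuQ}),
    [/\ forall (x : nat -> H) (hx : admissible nuH x),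
          exists hfx : admissible nuG (f \o x),
            fhat (cone_class w hx) = cone_class w hfx,
        forall (x : nat -> G) (hx : admissible nuG x),
          exists hgx : admissible nuQ (g \o x),
            ghat (cone_class w hx) = cone_class w hgx,
        continuous fhat,
        continuous ghat
      & short_exact fhat ghat].
Proof.
move=> [f_inj f_ker g_surj] nuGS [A [B [A1 B0 f_qi]]] nuQS w_np.
have A0 : 0 < A by apply: lt_le_trans A1.
have f_le h : nuG (f h) <= A * nuH h + B.
  by have /andP[_] := f_qi h 1%g; rewrite ghom1 !norm_dist1.
(* The lower bound at the pair [h], [1], multiplied by [A]. *)
have f_ge h : nuH h <= A * nuG (f h) + A * B.
  have /andP[+ _] := f_qi h 1%g; rewrite ghom1 !norm_dist1 lerBlDr.
  by rewrite ler_pdivrMl// mulrDr.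
have g_le x : nuQ (g x) <= 1 * nuG x + 0.
  by rewrite mul1r addr0; exact: word_norm_image_le nuGS nuQS x.
have gf1 h : g (f h) = 1%g.
  have : range f (f h) by exists h.
  by rewrite f_ker.
have [fhat [fhatE fhat_cont]] := cone_map_exists w_np A0 B0 f_le.
have [ghat [ghatE ghat_cont]] := cone_map_exists w_np ltr01 (lexx 0) g_le.
exists fhat, ghat; split=> //.
have [lift liftP] := choice (fun q => word_norm_lift nuGS nuQS q g_surj).
split.
- move=> a b; elim/cone_class_ind: a => x hx; elim/cone_class_ind: b => y hy.
  have [hfx ->] := fhatE x hx; have [hfy ->] := fhatE y hy.
  move=> /cone_classP fxy; apply/cone_classP.
  (* Injectivity: [f_ge] at [x n * (y n)^-1] bounds the scaled distance in [H] by the one in [G]. *)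
  apply: (@cvg0_affine_le R w wU w_np A (A * B)) fxy => n.
  rewrite scaled_dist_ge0 /scaled_dist /norm_dist /= -ghomV -gmulfM.
  by rewrite mulrA -mulrDl ler_pM2r ?invr_gt0.
- apply/seteqP; split=> [_ [a _ <-]|b] /=.
    elim/cone_class_ind: a => x hx.
    have [hfx ->] := fhatE x hx; have [hgfx ->] := ghatE _ hfx.
    apply/cone_class_eq1.
    rewrite (_ : (fun n => _) = cst 0); first exact: cvg_cst.
    by apply/funext => n /=; rewrite gf1 cinorm1 mul0r.
  elim/cone_class_ind: b => x hx.
  have [hgx ->] := ghatE x hx; move=> /cone_class_eq1 gx0.
  pose y n := lift (g (x n)).
  have gy n : g (y n) = g (x n) by have [] := liftP (g (x n)).
  have y_le n : nuG (y n) <= nuQ (g (x n)) by have [] := liftP (g (x n)).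
  have hP n : exists h, f h = (x n * (y n)^-1)%g.
    have : range f (x n * (y n)^-1)%g.
      by rewrite f_ker /= gmulfM ghomV gy mulgV.
    by case=> h _ fh; exists h.
  have [h fh] := choice hP.
  have hh : admissible nuH h.
    have [C xC] := hx; have [D gxD] := hgx.
    (* [C] bounds the scaled norm of [x n], and [D] that of [g (x n)], hence of [y n]; so [C + D]
       bounds that of [f (h n)], and [f_ge] carries the bound back to [h n]. *)
    exists (A * (C + D) + A * B) => n.
    apply: le_trans (_ : (A * nuG (f (h n)) + A * B) / n.+1%:R <= _).
      by rewrite ler_pM2r ?invr_gt0.
    rewrite mulrDl; apply: lerD; last first.
      by rewrite ler_pdivrMr// ler_peMr ?ler1n// mulr_ge0// ltW.
    rewrite -mulrA ler_pM2l// fh; apply: le_trans (lerD (xC n) (gxD n)).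
    rewrite -mulrDl ler_pM2r ?invr_gt0//.
    by apply: le_trans (cinormM _ _ _) _; rewrite cinormV lerD2l y_le.
  exists (cone_class w hh) => //.
  have [hfh ->] := fhatE h hh; apply/cone_classP.
  apply: squeeze0 gx0 => n; rewrite scaled_dist_ge0 /=.
  (* The quotient of [x n] by [f (h n)] is [x n * y n * (x n)^-1], a conjugate of [y n], so it has
     the norm of [y n]. *)
  rewrite scaled_dist_sym /scaled_dist /norm_dist /= fh invgM invgK.
  rewrite ler_pM2r ?invr_gt0//.
  by rewrite mulgA cinormJ y_le.
- apply/seteqP; split=> // b _; elim/cone_class_ind: b => q hq.
  have lift_adm : admissible nuG (lift \o q).
    have [C qC] := hq; exists C => n; apply: le_trans (qC n).
    by rewrite ler_pM2r ?invr_gt0//; have [] := liftP (q n).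
  exists (cone_class w lift_adm) => //.
  have [hgl ->] := ghatE _ lift_adm; apply/cone_classP.
  (* The lift is exact in every term, so the distance vanishes identically and not just in the
     limit. *)
  rewrite (_ : scaled_dist _ _ _ = cst 0); first exact: cvg_cst.
  apply/funext => n; rewrite /scaled_dist /=.
  by have [-> _] := liftP (q n); rewrite norm_distxx mul0r.
Qed.
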